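(* For integers $t\ge 0$ and $n\ge 0$, let $WK_t(n)$ be the number of vectors $(n_1,\dots,n_t)\in\{0,1,\dots,n\}^t$ such that $n_i+n_j\le n$ for all $1\le i<j\le t$ (with $WK_0(n)=1$), and let $U_t(x)=\sum_{n=0}^\infty WK_t(n)x^n$. For $t\ge 1$ let $A_t(x)=\sum_{k=1}^{t}A(t,k)x^k$ be the Eulerian polynomial, where $A(t,k)$ is the number of permutations of $\{1,\dots,t\}$ with exactly $k-1$ descents. Then for every $t\ge 2$, $$p_{2t-4}(x):=\frac{A_t(x^2)+t\,x\,A_{t-1}(x^2)}{x^2(1+x)^2}$$ is a polynomial of degree $2t-4$, and, as formal power series in $x$ and $y$, $$\sum_{t=0}^\infty U_t(x)\frac{y^t}{t!}=\frac{1}{1-x}+\frac{y}{(1-x)^2}+\sum_{t=2}^\infty \frac{p_{2t-4}(x)}{(1-x)^3(1-x^2)^{t-2}}\,\frac{y^t}{t!}.$$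
   Context: $WK_t(n)$ counts the weightings of the vertices of the complete graph $K_t$ by integers in $\{0,1,\dots,n\}$ such that the weights of any two adjacent (here: any two distinct) vertices sum to at most $n$. A descent of a permutation $p_1p_2\cdots p_t$ is an index $i$ with $p_i>p_{i+1}$. *)

(* Defs.v *)
From HB Require Import structures.
From mathcomp Require Import all_boot all_order all_fingroup all_algebra.
From mathcomp Require Import boolp.

Set Implicit Arguments.
Unset Strict Implicit.
Unset Printing Implicit Defensive.
Set Warnings "-redundant-canonical-projection".

Import GRing.Theory.
Local Open Scope ring_scope.

(* Formal power series over R, with the Cauchy product; [Fps c] is the series *)
(* whose coefficient of degree n is c n.  Bivariate series in x and y are     *)
(* represented as series in y over series in x, i.e. {fps {fps R}}.           *)
Record fps (R : Type) := Fps { fcoef : nat -> R }.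

Notation "{ 'fps' R }" := (fps R) (at level 0, format "{ 'fps'  R }") :
  type_scope.

Lemma fpsP (R : Type) (f g : {fps R}) : fcoef f =1 fcoef g <-> f = g.
Proof.
split=> [|-> //]; case: f g => [f] [g] /= eq_fg.
by congr Fps; apply/funext.
Qed.

HB.instance Definition _ (R : Type) := gen_eqMixin {fps R}.
HB.instance Definition _ (R : Type) := gen_choiceMixin {fps R}.

Section FpsZmodule.
Variable R : zmodType.
Implicit Types f g h : {fps R}.

Definition fps_zero : {fps R} := Fps (fun=> 0).
Definition fps_opp f : {fps R} := Fps (fun n => - fcoef f n).
Definition fps_add f g : {fps R} := Fps (fun n => fcoef f n + fcoef g n).

Fact fps_addA : associative fps_add.
Proof. by move=> f g h; apply/fpsP => n /=; rewrite addrA. Qed.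
Fact fps_addC : commutative fps_add.
Proof. by move=> f g; apply/fpsP => n /=; rewrite addrC. Qed.
Fact fps_add0 : left_id fps_zero fps_add.
Proof. by move=> f; apply/fpsP => n /=; rewrite add0r. Qed.
Fact fps_addN : left_inverse fps_zero fps_opp fps_add.
Proof. by move=> f; apply/fpsP => n /=; rewrite addNr. Qed.

HB.instance Definition _ := GRing.isZmodule.Build {fps R}
  fps_addA fps_addC fps_add0 fps_addN.

End FpsZmodule.

Section FpsRing.
Variable R : comNzRingType.
Implicit Types f g h : {fps R}.

Definition fps_one : {fps R} := Fps (fun n => (n == 0%N)%:R).
Definition fps_mul f g : {fps R} :=
  Fps (fun n => \sum_(i < n.+1) fcoef f i * fcoef g (n - i)).

Fact fcoef_mul_rev f g n :
  fcoef (fps_mul f g) n = \sum_(i < n.+1) fcoef f (n - i) * fcoef g i.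
Proof.
rewrite /= (reindex_inj rev_ord_inj) /=.
by apply: eq_bigr => i _; rewrite subSS subKn // -ltnS.
Qed.

Fact fps_mulC : commutative fps_mul.
Proof.
move=> f g; apply/fpsP => n; rewrite fcoef_mul_rev /=.
by apply: eq_bigr => i _; rewrite mulrC.
Qed.

Fact fps_mulA : associative fps_mul.
Proof.
move=> p q r; apply/fpsP => i; rewrite [RHS]fcoef_mul_rev.
pose coef3 j k := fcoef p j * (fcoef q (i - j - k) * fcoef r k).
transitivity (\sum_(j < i.+1) \sum_(k < i.+1 | (k <= i - j)%N) coef3 j k).
  change (\sum_(j < i.+1) fcoef p j * fcoef (fps_mul q r) (i - j) =
          \sum_(j < i.+1) \sum_(k < i.+1 | (k <= i - j)%N) coef3 j k).
  apply: eq_bigr => j _; rewrite fcoef_mul_rev big_distrr /=.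
  by rewrite (big_ord_narrow_leq (leq_subr _ _)).
rewrite (exchange_big_dep predT) //=; apply: eq_bigr => k _.
transitivity (\sum_(j < i.+1 | (j <= i - k)%N) coef3 j k).
  apply: eq_bigl => j; rewrite -ltnS -(ltnS j) -!subSn ?leq_ord //.
  by rewrite -subn_gt0 -(subn_gt0 j) -!subnDA addnC.
rewrite (big_ord_narrow_leq (leq_subr _ _)) big_distrl /=.
by apply: eq_bigr => j _; rewrite /coef3 -!subnDA addnC mulrA.
Qed.

Fact fps_mul1 : left_id fps_one fps_mul.
Proof.
move=> f; apply/fpsP => n /=; rewrite big_ord_recl /= mul1r subn0.
by rewrite big1 ?addr0 // => i _; rewrite mul0r.
Qed.

Fact fps_mulDl : left_distributive fps_mul +%R.
Proof.
move=> f g h; apply/fpsP => n /=; rewrite -big_split /=.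
by apply: eq_bigr => i _; rewrite mulrDl.
Qed.

Fact fps_one_neq0 : fps_one != 0.
Proof.
apply/eqP => /fpsP/(_ 0%N) /= /eqP; exact/negP/oner_neq0.
Qed.

HB.instance Definition _ := GRing.Zmodule_isComNzRing.Build {fps R}
  fps_mulA fps_mulC fps_mul1 fps_mulDl fps_one_neq0.

Lemma fcoefM f g n :
  fcoef (f * g) n = \sum_(i < n.+1) fcoef f i * fcoef g (n - i).
Proof. by []. Qed.

Lemma fcoefM_rev f g n :
  fcoef (f * g) n = \sum_(i < n.+1) fcoef f (n - i) * fcoef g i.
Proof. exact: fcoef_mul_rev. Qed.

Lemma fcoef1 n : fcoef (1 : {fps R}) n = (n == 0%N)%:R.
Proof. by []. Qed.

Definition fpsC (c : R) : {fps R} := Fps (fun n => if n == 0%N then c else 0).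
Definition fpsX : {fps R} := Fps (fun n => (n == 1%N)%:R).
Definition fps_of_poly (p : {poly R}) : {fps R} := Fps (fun n => p`_n).

Lemma fcoefXn k n : fcoef (fpsX ^+ k) n = (n == k)%:R.
Proof.
elim: k n => [|k IHk] [|n]; rewrite ?expr0 ?exprS ?fcoef1 // fcoefM.
  by rewrite big_ord_recl big_ord0 addr0 mul0r.
rewrite !big_ord_recl /= mul0r add0r mul1r /= IHk subSS subn0 eqSS.
by rewrite big1 ?addr0 // => i _; rewrite mul0r.
Qed.

Lemma fcoefCM c f n : fcoef (fpsC c * f) n = c * fcoef f n.
Proof.
rewrite fcoefM big_ord_recl subn0 big1 ?addr0 // => i _.
by rewrite [fcoef (fpsC c) _]/= mul0r.
Qed.

(* [Fps c] is the sum \sum_k c_k X^k, in the X-adic sense.                    *)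
Lemma fcoef_sum_CX (c : nat -> R) n m : (m < n)%N ->
  fcoef (\sum_(k < n) fpsC (c k) * fpsX ^+ k) m = fcoef (Fps c) m.
Proof.
move=> lt_mn; have fcoef_sum (F : nat -> {fps R}) :
    fcoef (\sum_(k < n) F k) m = \sum_(k < n) fcoef (F k) m.
  by elim/big_rec2: _ => // k u v _ /= ->.
rewrite (fcoef_sum (fun k => fpsC (c k) * fpsX ^+ k)).
rewrite (bigD1 (Ordinal lt_mn)) // fcoefCM fcoefXn eqxx mulr1.
rewrite big1 => [|k neq_km]; first by rewrite /= addr0.
rewrite fcoefCM fcoefXn.
by rewrite (negPf (_ : m != k)) ?mulr0 // eq_sym; apply: contra neq_km.
Qed.

End FpsRing.

Arguments fpsX {R}.

Section FpsUnitRing.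
Variable R : comUnitRingType.
Implicit Types f g h : {fps R}.

Definition fps_unit : pred {fps R} := fun f => fcoef f 0 \is a GRing.unit.

(* [fps_inv_seq f n] lists the first n coefficients of the inverse g of f,    *)
(* obtained by solving \sum_(i <= m) f_(m - i) * g_i = (m == 0) for g_m.      *)
Fixpoint fps_inv_seq f (n : nat) : seq R :=
  if n is m.+1 then
    let s := fps_inv_seq f m in
    rcons s ((fcoef f 0)^-1 *
             ((m == 0%N)%:R - \sum_(i < m) fcoef f (m - i) * s`_i))
  else [::].

Definition fps_inv f : {fps R} :=
  if fps_unit f then Fps (fun n => (fps_inv_seq f n.+1)`_n) else f.

Fact size_fps_inv_seq f n : size (fps_inv_seq f n) = n.
Proof. by elim: n => //= n IHn; rewrite size_rcons IHn. Qed.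

Fact nth_fps_inv_seq f n i : (i < n)%N ->
  (fps_inv_seq f n)`_i = (fps_inv_seq f i.+1)`_i.
Proof.
elim: n => // n IHn; rewrite ltnS leq_eqVlt => /predU1P[-> //|lt_in].
by rewrite -IHn // [LHS]/= nth_rcons size_fps_inv_seq lt_in.
Qed.

Fact fps_mulV : {in fps_unit, left_inverse 1 fps_inv *%R}.
Proof.
move=> f f_unit; apply/fpsP => n; rewrite mulrC fcoefM_rev fcoef1 /fps_inv ifT //.
pose g i := (fps_inv_seq f i.+1)`_i.
change (\sum_(i < n.+1) fcoef f (n - i) * g i = (n == 0%N)%:R).
have -> : \sum_(i < n.+1) fcoef f (n - i) * g i =
    \sum_(i < n) fcoef f (n - i) * (fps_inv_seq f n)`_i + fcoef f 0 * g n.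
  rewrite big_ord_recr /= subnn; congr (_ + _).
  by apply: eq_bigr => i _; rewrite nth_fps_inv_seq.
by rewrite /g /= nth_rcons size_fps_inv_seq ltnn eqxx mulrA divrr // mul1r subrKC.
Qed.

Fact fps_unitPl f g : g * f = 1 -> fps_unit f.
Proof.
move=> /fpsP/(_ 0%N); rewrite fcoefM big_ord_recl big_ord0 addr0 => gf1.
by apply/unitrPr; exists (fcoef g 0); rewrite mulrC.
Qed.

Fact fps_inv_out : {in [predC fps_unit], fps_inv =1 id}.
Proof. by move=> f /negPf f_nonunit; rewrite /fps_inv ifF. Qed.

HB.instance Definition _ := GRing.ComNzRing_hasMulInverse.Build {fps R}
  fps_mulV fps_unitPl fps_inv_out.

End FpsUnitRing.

Definition WK (t n : nat) : nat :=
  #|[set w : {ffun 'I_t -> 'I_n.+1} |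
      [forall i : 'I_t, forall j : 'I_t, (i < j)%N ==> (w i + w j <= n)%N]]|.

Definition U (t : nat) : {fps rat} := Fps (fun n => (WK t n)%:R).

Definition descents (t : nat) (s : 'S_t) : {set 'I_t} :=
  [set i : 'I_t | [exists j : 'I_t, (j == i.+1 :> nat) && (s j < s i)%N]].

(* With #|descents s|.+1 == k instead of == k.-1, eulerian t 0 = 0.             *)
Definition eulerian (t k : nat) : nat :=
  #|[set s : 'S_t | #|descents s|.+1 == k]|.

Definition eulerian_poly (t : nat) : {poly rat} :=
  \sum_(1 <= k < t.+1) (eulerian t k)%:R *: 'X^k.

(* Main.v *)
From HB Require Import structures.
Require Import Defs.
From mathcomp Require Import all_boot all_order all_fingroup all_algebra.
From mathcomp Require Import ring zify.

(* A vector counted by WK_t(n) either has all its entries at most n/2, or     *)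
(* exactly one entry m > n/2, the others being at most n - m.  Hence          *)
(*   WK_t(n) = (floor(n/2) + 1)^t + t * sum_(1 <= k <= ceil(n/2)) k^(t-1).    *)
(* The Eulerian polynomials satisfy A_(t+1) = x(1-x) A_t' + (t+1) x A_t, by   *)
(* insertion of the maximal letter into a permutation; applying x d/dx        *)
(* repeatedly this yields sum_k k^t x^(2k) = A_t(x^2) / (1-x^2)^(t+1), so     *)
(*   x^2 U_t (1-x^2)^(t+1) = (1+x) (A_t(x^2) + t x A_(t-1)(x^2)).             *)
(* The last factor has a double root at -1 because A_t(1) = t A_(t-1)(1) and  *)
(* 2 A_t'(1) = (t+1) A_t(1), both consequences of the recurrence.             *)

Set Implicit Arguments.
Unset Strict Implicit.
Unset Printing Implicit Defensive.

Import GRing.Theory.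
Local Open Scope ring_scope.

(** The coefficients of y^t are compared one at a time; t = 0 and t = 1 are immediate ([mul1B_U0],
    [mul1B_U1]). For t >= 2, [WK_eq] has two terms. In generating functions a power of floor(n/2) +
    1 costs a factor 1 + x ([low_gf]), and the partial sum up to ceil(n/2) costs a factor 1/(1-x)
    ([peak_gf]). So U_t combines two series sum_k k^s x^(2k), for s = t and s = t-1, which
    [even_powers_eulerian] evaluates by means of the insertion recurrence [eulerian_poly_rec]; the
    result is [U_numer]. Its denominator (1-x^2)^(t+1) shrinks to (1-x)^3 (1-x^2)^(t-2) because
    (1+x)^3 cancels: one factor 1+x is explicit in [U_numer], the other two come from the double
    root of the numerator at -1 ([numer_dvd]). *)

(** * Eulerian recurrence *)

(* Only meaningful for k <= t: [inord k] is [ord0] beyond. *)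
Definition word t (s : 'S_t.+1) (k : nat) : nat := s (inord k).

Lemma mem_descents t (s : 'S_t.+1) (i : 'I_t.+1) :
  (i \in descents s) = (i < t)%N && (word s i.+1 < word s i)%N.
Proof.
rewrite inE /word inord_val;
apply/existsP/andP => [[j /andP[/eqP ij sij]]|[it sij]].
  by rewrite -ij inord_val sij -ltnS.
by exists (inord i.+1); rewrite inordK // eqxx.
Qed.

Lemma card_descents t (s : 'S_t.+1) :
  #|descents s| = (\sum_(0 <= k < t) (word s k.+1 < word s k))%N.
Proof.
rewrite -sum1_card big_mkcond big_ord_recr /= mem_descents ltnn addn0 big_mkord.
by apply: eq_bigr => i _; rewrite mem_descents /= ltn_ord; case: ltnP.
Qed.

(** Shows that [lift_perm i ord_max s] is the word of s with the new maximum inserted at position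
    i. *)
Lemma word_lift_perm t (i : 'I_t.+2) (s : 'S_t.+1) k : (k < t.+2)%N ->
  word (lift_perm i ord_max s) k =
  if (k < i)%N then word s k else if k == i then t.+1 else word s k.-1.
Proof.
move=> kt; rewrite /word; have [ki|ki|ki] := ltngtP k i.
- have -> : inord k = lift i (inord k : 'I_t.+1).
    apply/val_inj; rewrite /= !inordK //; last by have := ltn_ord i; lia.
    by rewrite /bump leqNgt ki.
  by rewrite lift_perm_lift lift_max.
- have -> : inord k = lift i (inord k.-1 : 'I_t.+1).
    apply/val_inj; rewrite /= !inordK //; last by lia.
    by rewrite /bump; lia.
  by rewrite lift_perm_lift lift_max.
- by rewrite ki inord_val lift_perm_id.
Qed.

Lemma word_le t (s : 'S_t.+1) k : (word s k <= t)%N.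
Proof. by rewrite -ltnS /word. Qed.

(** A maximum placed in front is followed by a smaller letter, and the other comparisons are only
    shifted. *)
Lemma card_descents_lift0 t (s : 'S_t.+1) :
  #|descents (lift_perm ord0 ord_max s)| = #|descents s|.+1.
Proof.
rewrite !card_descents big_ltn // !word_lift_perm //= ltnS word_le add1n.
rewrite big_add1 /=; congr _.+1; apply: eq_big_nat => k kt.
by rewrite !word_lift_perm //; lia.
Qed.

(* Inserting the maximum just after position j creates no descent exactly     *)
(* when j is a descent or the last position.                                  *)
Lemma card_descents_lift t (s : 'S_t.+1) (j : 'I_t.+1) :
  #|descents (lift_perm (lift ord0 j) ord_max s)| =
  (#|descents s| + (j \notin ord_max |: descents s))%N.
Proof.
have jt := ltn_ord j; have le_w k : (word s k <= t)%N := word_le s k.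
rewrite !card_descents in_setU1 mem_descents -val_eqE /=.
set L := lift_perm _ _ _.
have wL k : (k <= j)%N -> word L k = word s k.
  by move=> kj; rewrite word_lift_perm /= /bump; [rewrite ifT //|]; lia.
have wLj : word L j.+1 = t.+1.
  by rewrite word_lift_perm /= ?/bump ?add1n ?ltnn ?eqxx //; lia.
have wLS k : (j.+1 < k <= t.+1)%N -> word L k = word s k.-1.
  by move=> kj; rewrite word_lift_perm /= /bump; [rewrite !ifF //|]; lia.
rewrite (big_cat_nat (n := j)) //=; last by lia.
rewrite (big_ltn jt) wLj wL // [(t.+1 < _)%N]ltnNge leqW // add0n.
rewrite (eq_big_nat _ _
    (F2 := fun k => nat_of_bool (word s k.+1 < word s k)%N));
  last by move=> k kj; rewrite !wL //; lia.
have [jE|jneq] := eqVneq (j : nat) t.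
  by rewrite jE [X in (_ + X)%N = _]big_geq // eqxx !addn0.
have {}jt : (j < t)%N by lia.
rewrite (@big_ltn _ _ _ j.+1) // wLj wLS ?ltnS ?le_w //; last by lia.
rewrite [in RHS](big_cat_nat (n := j)) //=; last by lia.
rewrite [in RHS](big_ltn jt) big_add1 /=.
have -> : (\sum_(j.+1 <= k < t) (word L k.+2 < word L k.+1) =
           \sum_(j.+1 <= k < t) (word s k.+1 < word s k))%N.
  by apply: eq_big_nat => k jk; rewrite !wLS //=; lia.
by rewrite jt; case: (word s j.+1 < word s j)%N => /=; lia.
Qed.

(** The position of the maximum and the remaining word can be read off the result, so the map is
    injective; both sides have (t+1)! elements. *)
Lemma lift_perm_bij t :
  bijective (fun u : 'I_t.+1 * 'S_t => lift_perm u.1 ord_max u.2).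
Proof.
apply: inj_card_bij; last first.
  by rewrite card_prod card_ord !card_Sn factS.
move=> [i s] [j s'] /= E.
have ij : i = j.
  by apply: (@perm_inj _ (lift_perm i ord_max s)); rewrite {2}E !lift_perm_id.
rewrite -{j}ij in E *; congr (_, _); apply/permP => k.
by have /permP/(_ (lift i k)) := E; rewrite !lift_perm_lift => /lift_inj.
Qed.

Lemma eulerian_polyE t :
  eulerian_poly t.+1 = \sum_(s : 'S_t.+1) 'X^(#|descents s|.+1).
Proof.
have ltd (s : 'S_t.+1) : (#|descents s| < t.+1)%N.
  rewrite card_descents ltnS -[X in (_ <= X)%N]subn0 -[(t - 0)%N]muln1.
  by rewrite -sum_nat_const_nat leq_sum // => k _; case: (_ < _)%N.
rewrite /eulerian_poly big_add1 /= big_mkord.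
rewrite (partition_big (fun s => Ordinal (ltd s)) predT) //=.
apply: eq_bigr => k _.
rewrite (eq_bigr (fun=> 'X^(k.+1))) => [|s /eqP <- //].
rewrite sumr_const scaler_nat; congr (_ *+ _); rewrite /eulerian.
by apply: eq_card => s; rewrite !inE.
Qed.

Lemma eulerian_poly1 : eulerian_poly 1 = 'X.
Proof.
rewrite eulerian_polyE (eq_bigr (fun=> 'X)) => [|s _].
  by rewrite sumr_const card_Sn.
by rewrite card_descents big_geq.
Qed.

(** Let s have d descents. Of the t+2 insertions of a maximum, d+1 keep d ([K] collects them) and
    the other t+1-d, the front included, give d+1. So s contributes (d+1) x^(d+1) + (t+1-d) x^(d+2),
    which is the right-hand side evaluated at x^(d+1). *)
Lemma eulerian_poly_rec t :
  eulerian_poly t.+2 = 'X * (1 - 'X) * (eulerian_poly t.+1)^`()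
                       + t.+2%:R *: ('X * eulerian_poly t.+1).
Proof.
rewrite [LHS]eulerian_polyE (reindex _ (onW_bij _ (lift_perm_bij _))).
rewrite -(pair_bigA _
  (fun i s => 'X^(#|descents (lift_perm i ord_max s)|.+1))) /=.
rewrite exchange_big /= eulerian_polyE (raddf_sum (@deriv _)).
rewrite !mulr_sumr scaler_sumr -big_split /=.
apply: eq_bigr => s _; set d := #|descents s|.
rewrite big_ord_recl card_descents_lift0 -/d.
have nmax : ord_max \notin descents s by rewrite mem_descents ltnn.
pose K := ord_max |: descents s; have cK : #|K| = d.+1 by rewrite cardsU1 nmax.
have cKC : #|~: K| = (t - d)%N.
  by have := cardsC K; rewrite cK card_ord; lia.
have d_le : (d <= t)%N by have := max_card K; rewrite cK card_ord.
rewrite (bigID (mem K)) /=.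
rewrite (eq_bigr (fun=> 'X^(d.+1))) => [|j jK]; last first.
  by rewrite card_descents_lift -/K jK addn0.
rewrite sumr_const cK (eq_bigr (fun=> 'X^(d.+2))) => [|j /negPf jK]; last first.
  by rewrite card_descents_lift -/K jK addn1.
rewrite (eq_bigl (mem (~: K))) => [|j]; last by rewrite !inE.
rewrite sumr_const cKC derivXn /= scaler_nat.
have natE (p : {poly rat}) n : p *+ n = n%:R * p by rewrite mulr_natl.
rewrite (natE _ d.+1) (natE 'X^(d.+2)) (natE _ d.+1) (natE _ t.+2).
rewrite natrB // !exprS.
ring.
Qed.

(** * Counting the weightings *)

Lemma card_ord_le n m : (m <= n)%N -> #|[pred v : 'I_n.+1 | (v <= m)%N]| = m.+1.
Proof.
move=> mn; rewrite -sum1_card -[RHS]card_ord -sum1_card /=.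
by rewrite (big_ord_widen n.+1 (fun=> 1%N)).
Qed.

Section CountWK.
Variables t n : nat.
Implicit Types (w : {ffun 'I_t -> 'I_n.+1}) (i : 'I_t) (m : 'I_n.+1).

Definition low : pred {ffun 'I_t -> 'I_n.+1} :=
  [pred w : {ffun 'I_t -> 'I_n.+1} | [forall i, (w i <= n./2)%N]].

(** For m > n/2 these are exactly the compatible weightings with value m at i. The form [family]
    makes the cardinality a product over positions. *)
Definition peak i m : pred {ffun 'I_t -> 'I_n.+1} :=
  family (fun j =>
    if j == i then pred1 m else [pred v : 'I_n.+1 | (v <= n - m)%N]).

Lemma card_low : #|low| = (n./2.+1 ^ t)%N.
Proof.
rewrite -[RHS](_ : #|[pred v : 'I_n.+1 | (v <= n./2)%N]| ^ #|'I_t| = _)%N.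
  rewrite -card_ffun_on; apply: eq_card => w.
  by rewrite [LHS]inE; apply/forallP/ffun_onP => h i; have := h i; rewrite inE.
by rewrite card_ord card_ord_le // leq_half_double; lia.
Qed.

Lemma card_peak i m : #|peak i m| = ((n - m).+1 ^ t.-1)%N.
Proof.
rewrite card_family foldrE big_map big_enum (bigD1 i) //= eqxx card1 mul1n.
rewrite (eq_bigr (fun=> (n - m).+1)) => [|j /negPf ->].
  by rewrite prod_nat_const cardC1 card_ord.
by rewrite card_ord_le // leq_subr.
Qed.

Lemma peakP i m w :
  reflect (w i = m /\ forall j, j != i -> (w j <= n - m)%N) (w \in peak i m).
Proof.
apply: (iffP familyP) => [h|[wi h] j].
  split=> [|j ji]; first by have := h i; rewrite eqxx inE => /eqP.
  by have := h j; rewrite (negPf ji) inE.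
by case: eqVneq => [->|/h]; rewrite inE ?wi.
Qed.

Definition compatible w :=
  [forall i : 'I_t, forall j : 'I_t, (i < j)%N ==> (w i + w j <= n)%N].

Lemma compatibleP w :
  reflect (forall i j, i != j -> (w i + w j <= n)%N) (compatible w).
Proof.
apply: (iffP idP) => [/forallP h i j|h].
  rewrite -val_eqE /= neq_ltn => /orP[] lt_ij.
    by have /forallP/(_ j)/implyP := h i; apply.
  by rewrite addnC; have /forallP/(_ i)/implyP := h j; apply.
apply/forallP => i; apply/forallP => j; apply/implyP => ij.
by apply: h; rewrite -val_eqE /= ltn_eqF.
Qed.

(* A compatible weighting has at most one weight above n/2. *)
Lemma compatible_split w :
  compatible w =
  (low w + \sum_(i : 'I_t) \sum_(m : 'I_n.+1 | (n./2 < m)%N) (w \in peak i m))%N :> nat.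
Proof.
have [lw|/forallPn[i]] := boolP (low w).
  have /compatibleP -> : forall i j, i != j -> (w i + w j <= n)%N.
    by move=> i j _; have := forallP lw i; have := forallP lw j; lia.
  rewrite big1 // => i _; rewrite big1 // => m hm.
  by case: peakP => // -[wi _]; have := forallP lw i; rewrite wi; lia.
rewrite -ltnNge => hi.
(* Among the peaks at position i only the one of height w i can contain w, so its term is
   isolated. *)
rewrite (bigD1 i) //= (bigD1 (w i)) //= addnA add0n.
rewrite [X in _ = (_ + X + _)%N]big1 ?addn0; last first.
  by move=> m /andP[_ hm]; case: peakP => // -[wi]; rewrite wi eqxx in hm.
case: compatibleP => h; last first.
  (* In this peak any two entries away from i are at most n - w i, hence sum to at most n, so
     membership would make w compatible. *)
  rewrite (_ : (w \in _) = false); last first.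
    apply/negP => /peakP[_ h']; apply: h => j k jk.
    have [ji|ji] := eqVneq j i; have [ki|ki] := eqVneq k i.
    - by rewrite ji ki eqxx in jk.
    - by have := h' _ ki; rewrite ji; have := ltn_ord (w i); lia.
    - by have := h' _ ji; rewrite ki; have := ltn_ord (w i); lia.
    - by have := h' _ ji; have := h' _ ki; lia.
  (* A peak of height m > n/2 at j != i would force w i <= n - m, against w i > n/2. *)
  apply/esym/eqP; rewrite sum_nat_eq0; apply/forallP => j; apply/implyP => ji.
  rewrite sum_nat_eq0; apply/forallP => m; apply/implyP => hm.
  by case: peakP => //= -[wj /(_ i)]; rewrite eq_sym ji => /(_ isT); lia.
rewrite (_ : (w \in _)); last first.
  by apply/peakP; split=> // j ji; have := h _ _ ji; lia.
apply/esym/eqP; rewrite eqSS sum_nat_eq0; apply/forallP => j.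
apply/implyP => ji.
rewrite sum_nat_eq0; apply/forallP => m; apply/implyP => hm.
by case: peakP => //= -[wj _]; have := h _ _ ji; rewrite wj; lia.
Qed.

Lemma WK_eq :
  WK t n = (n./2.+1 ^ t + t * \sum_(1 <= k < (uphalf n).+1) k ^ t.-1)%N.
Proof.
transitivity (\sum_w compatible w)%N.
  rewrite /WK cardsE -sum1_card big_mkcond; apply: eq_bigr => w _.
  by rewrite (_ : (w \in _) = compatible w) //; case: compatible.
under eq_bigr do rewrite compatible_split.
rewrite big_split /= exchange_big /=; congr (_ + _)%N.
  rewrite -card_low -sum1_card [RHS]big_mkcond; apply: eq_bigr => w _.
  by rewrite (_ : (w \in _) = low w) //; case: (low w).
rewrite (eq_bigr (fun=> \sum_(1 <= k < (uphalf n).+1) k ^ t.-1)%N) => [|i _].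
  by rewrite sum_nat_const card_ord.
rewrite exchange_big /=.
rewrite (eq_bigr (fun m : 'I_n.+1 => (n - m).+1 ^ t.-1)%N) => [|m _];
  last first.
  rewrite -(card_peak i) -sum1_card [RHS]big_mkcond.
  by apply: eq_bigr => w _; case: (w \in _).
(* Substituting k = n - m turns the condition m > floor(n/2) into k < ceil(n/2). *)
rewrite (reindex_inj rev_ord_inj) /= big_add1 /= big_mkord.
rewrite (big_ord_widen n.+1 (fun k => k.+1 ^ t.-1)%N); last by lia.
apply: eq_big => [k|k _]; first by have := ltn_ord k; lia.
by rewrite subSS subKn // -ltnS.
Qed.

End CountWK.

(** * Generating functions *)

Section FpsFacts.
Variable R : comNzRingType.
Implicit Types (f g : {fps R}) (p : {poly R}).

Lemma fcoefD f g n : fcoef (f + g) n = fcoef f n + fcoef g n.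
Proof. by []. Qed.

Lemma fcoefN f n : fcoef (- f) n = - fcoef f n.
Proof. by []. Qed.

Lemma fcoefMn f k n : fcoef (f *+ k) n = fcoef f n *+ k.
Proof. by elim: k => // k IHk; rewrite !mulrS fcoefD IHk. Qed.

Lemma fcoefXM f n : fcoef (fpsX * f) n = if n is m.+1 then fcoef f m else 0.
Proof.
rewrite fcoefM; case: n => [|n].
  by rewrite big_ord_recl big_ord0 addr0 /= mul0r.
rewrite !big_ord_recl /= mul0r add0r mul1r subSS subn0 big1 ?addr0 // => i _.
by rewrite mul0r.
Qed.

Lemma fps_of_poly_is_monoid_morphism : monoid_morphism (@fps_of_poly R).
Proof.
split; first by apply/fpsP => n; rewrite /= coef1.
by move=> p q; apply/fpsP => n; rewrite /= coefM.
Qed.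

Lemma fps_of_poly_is_zmod_morphism : zmod_morphism (@fps_of_poly R).
Proof. by move=> p q; apply/fpsP => n; rewrite /= coefB. Qed.

HB.instance Definition _ := GRing.isZmodMorphism.Build {poly R} {fps R}
  (@fps_of_poly R) fps_of_poly_is_zmod_morphism.
HB.instance Definition _ := GRing.isMonoidMorphism.Build {poly R} {fps R}
  (@fps_of_poly R) fps_of_poly_is_monoid_morphism.

Lemma fps_of_poly1 : fps_of_poly 1 = 1 :> {fps R}.
Proof. exact: rmorph1. Qed.

Lemma fps_of_polyB : {morph @fps_of_poly R : p q / p - q}.
Proof. exact: rmorphB. Qed.

Lemma fps_of_polyM : {morph @fps_of_poly R : p q / p * q}.
Proof. exact: rmorphM. Qed.

Lemma fps_of_polyX : fps_of_poly 'X = fpsX :> {fps R}.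
Proof. by apply/fpsP => n; rewrite /= coefX. Qed.

(* The derivation x d/dx. *)
Definition theta f : {fps R} := Fps (fun n => fcoef f n *+ n).

Lemma thetaM f g : theta (f * g) = theta f * g + f * theta g.
Proof.
apply/fpsP => n; rewrite [LHS]/= fcoefD !fcoefM -sumrMnl -big_split /=.
apply: eq_bigr => i _; rewrite mulrnAl mulrnAr -mulrnDr subnKC //.
by rewrite -ltnS.
Qed.

Lemma thetaB f g : theta (f - g) = theta f - theta g.
Proof. by apply/fpsP => n; rewrite /= mulrnBl. Qed.

Lemma theta1 : theta 1 = 0.
Proof. by apply/fpsP => -[|n] /=; rewrite ?mul0rn. Qed.

Lemma thetaXn k : theta (fpsX ^+ k) = fpsX ^+ k *+ k.
Proof.
apply/fpsP => n; rewrite fcoefMn fcoefXn /= fcoefXn.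
by case: eqVneq => [->|]; rewrite ?mul0rn.
Qed.

Lemma theta_exp f m : theta (f ^+ m.+1) = f ^+ m * theta f *+ m.+1.
Proof.
elim: m => [|m IHm]; first by rewrite expr1 expr0 mul1r.
by rewrite exprS thetaM IHm mulrnAr mulrA -exprS [theta f * _]mulrC -mulrS.
Qed.

Lemma theta_fps_of_poly p : theta (fps_of_poly p) = fps_of_poly ('X * p^`()).
Proof.
apply/fpsP => -[|n] /=; rewrite coefXM ?mulr0n //=.
by rewrite coef_deriv.
Qed.

(** x is not a unit, so powers of x are removed by cancellation instead of division. *)
Lemma fpsX_lreg : GRing.lreg (fpsX : {fps R}).
Proof.
move=> f g /fpsP fg; apply/fpsP => n.
by have := fg n.+1; rewrite !fcoefXM.
Qed.

End FpsFacts.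

Lemma fps_unit1B (R : comUnitRingType) k :
  (1 - fpsX ^+ k.+1 : {fps R}) \is a GRing.unit.
Proof.
rewrite -[_ \is a _]/(fcoef (1 - fpsX ^+ k.+1 : {fps R}) 0 \is a GRing.unit).
by rewrite fcoefD fcoefN fcoefXn subr0 unitr1.
Qed.

Section GeneratingFunctions.
Local Notation x := (fpsX : {fps rat}).

(* sum_k k^t x^(2k) *)
Definition even_powers t : {fps rat} :=
  Fps (fun n => if odd n then 0 else (n./2 ^ t)%:R).

Lemma theta_even_powers t : theta (even_powers t) = even_powers t.+1 *+ 2.
Proof.
apply/fpsP => n; rewrite fcoefMn /=.
case: ifP => odd_n; first by rewrite !mul0rn.
rewrite -!mulrnA; congr (_ *+ _); rewrite expnSr -mulnA; congr (_ * _)%N.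
by have := odd_double_half n; rewrite odd_n; lia.
Qed.


(** Induction by applying [theta] to the identity and multiplying by u = 1 - x^2: the term from
    differentiating the power of u matches the multiple of x^2 A(x^2) in [eulerian_poly_rec]. *)
Lemma even_powers_eulerian t :
  even_powers t.+1 * (1 - x ^+ 2) ^+ t.+2 =
  fps_of_poly (eulerian_poly t.+1 \Po 'X^2).
Proof.
have theta_u : theta (1 - x ^+ 2) = - (x ^+ 2 *+ 2).
  by rewrite thetaB theta1 thetaXn sub0r.
(* Each use of [theta] on a series in x^2 produces a factor 2, which has to be cancelled. *)
have dbl (f g : {fps rat}) : f *+ 2 = g *+ 2 -> f = g.
  move=> /fpsP fg; apply/fpsP => n; have := fg n; rewrite !fcoefMn => /eqP.
  by rewrite Num.Theory.eqr_pMn2r // => /eqP.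
elim: t => [|t IHt].
  (* The base case is [theta] applied to the geometric series, whose constant coefficient relies on
     0^0 = 1. *)
  have E0 : even_powers 0 * (1 - x ^+ 2) = 1.
    apply/fpsP => n; rewrite mulrC mulrBl mul1r expr2 -mulrA.
    rewrite fcoefD fcoefN fcoefXM.
    case: n => [|n]; rewrite ?subr0 // fcoefXM.
    by case: n => [|n] /=; rewrite ?subr0 ?negbK ?subrr.
  have := congr1 (@theta _) E0; rewrite thetaM theta_even_powers theta_u theta1.
  rewrite eulerian_poly1 comp_polyX rmorphXn /= fps_of_polyX => E1.
  apply: dbl; transitivity ((even_powers 0 * (1 - x ^+ 2)) * (x ^+ 2 *+ 2)).
    have {E1}: even_powers 1 *+ 2 * (1 - x ^+ 2) =
        even_powers 0 * (x ^+ 2 *+ 2).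
      by apply/eqP; rewrite -subr_eq0 -E1 mulrN.
    by rewrite mulrAC => <-; ring.
  by rewrite E0 mul1r.
have := congr1 (@theta _) IHt.
rewrite thetaM theta_even_powers theta_fps_of_poly theta_exp theta_u.
set A := eulerian_poly t.+1 in IHt *; rewrite deriv_comp derivXn /= expr1.
set H := even_powers _ in IHt *; set B := fps_of_poly (A \Po _) in IHt *.
have -> : fps_of_poly ('X * ((A^`() \Po 'X^2) * ('X *+ 2))) =
  x ^+ 2 * fps_of_poly (A^`() \Po 'X^2) *+ 2.
  by rewrite !rmorphM /= rmorphMn /= fps_of_polyX; ring.
set B' := fps_of_poly (A^`() \Po 'X^2) => E.
have X2 : fps_of_poly 'X^2 = x ^+ 2 by rewrite rmorphXn /= fps_of_polyX.
have -> : fps_of_poly (eulerian_poly t.+2 \Po 'X^2) =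
    x ^+ 2 * (1 - x ^+ 2) * B' + (x ^+ 2 * B) *+ t.+2.
  rewrite eulerian_poly_rec comp_polyD comp_polyZ !comp_polyM comp_polyB.
  rewrite !comp_polyX -polyC1 comp_polyC polyC1 scaler_nat rmorphD rmorphMn /=.
  by rewrite !(X2, fps_of_poly1, fps_of_polyB, fps_of_polyM).
set u := 1 - x ^+ 2 in IHt E *.
apply: dbl; transitivity (u * (x ^+ 2 * B' *+ 2) + (x ^+ 2 * B) *+ t.+2 *+ 2).
  by rewrite -E -IHt !exprS; ring.
by ring.
Qed.

Definition numer t : {poly rat} :=
  (eulerian_poly t \Po 'X^2) + t%:R *: 'X * (eulerian_poly (t - 1)%N \Po 'X^2).

Lemma low_gf t :
  x ^+ 2 * Fps (fun n => (n./2.+1 ^ t.+1)%:R) = (1 + x) * even_powers t.+1.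
Proof.
apply/fpsP => n; rewrite expr2 -mulrA mulrDl mul1r fcoefD fcoefXM.
case: n => [|n]; rewrite !fcoefXM /=; first by rewrite exp0n ?addr0.
case: n => [|n] /=; first by rewrite exp0n ?addr0.
by rewrite !negbK uphalf_half; case: (odd n); rewrite ?add0r ?addr0.
Qed.

(** Multiplying by 1 - x takes differences of consecutive coefficients; ceil(n/2) grows only when n
    becomes odd, and the extra x moves these places to even degrees. *)
Lemma peak_gf t :
  (1 - x) * (x * Fps (fun n => (\sum_(1 <= k < (uphalf n).+1) k ^ t.+1)%:R)) =
  even_powers t.+1.
Proof.
apply/fpsP => n; rewrite mulrBl mul1r fcoefD fcoefN !fcoefXM.
case: n => [|n]; first by rewrite subr0 /= exp0n.
case: n => [|n]; first by rewrite !fcoefXM subr0 [LHS]/= big_geq.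
rewrite fcoefXM [in LHS]/= [in RHS]/= negbK (uphalf_half n).
case: (odd n); rewrite ?add1n ?add0n ?subrr //.
by rewrite big_nat_recr //= natrD addrC addKr.
Qed.

Lemma U_numer t :
  x ^+ 2 * U t.+2 * (1 - x ^+ 2) ^+ t.+3 =
  (1 + x) * fps_of_poly (numer t.+2).
Proof.
have -> : U t.+2 = Fps (fun n => (n./2.+1 ^ t.+2)%:R) +
    t.+2%:R * Fps (fun n => (\sum_(1 <= k < (uphalf n).+1) k ^ t.+1)%:R).
  apply/fpsP => n; rewrite mulr_natl fcoefD fcoefMn /= WK_eq.
  by rewrite natrD natrM mulr_natl.
have := low_gf t.+1; have := peak_gf t.
set Q := Fps _; set P := Fps _ => HQ HP.
rewrite mulrDr HP mulrDl -mulrA even_powers_eulerian.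
have -> : fps_of_poly (numer t.+2) = fps_of_poly (eulerian_poly t.+2 \Po 'X^2) +
    t.+2%:R * x * fps_of_poly (eulerian_poly t.+1 \Po 'X^2).
  rewrite /numer subn1 /= scaler_nat rmorphD /= fps_of_polyM rmorphMn /=.
  by rewrite fps_of_polyX mulr_natl.
(* The exposed factor 1 - x^2 = (1-x)(1+x) supplies the 1-x required by [HQ] and leaves the common
   1+x. *)
rewrite -(even_powers_eulerian t) -HQ [_ ^+ t.+3]exprS.
set B := fps_of_poly _; set V := _ ^+ t.+2.
ring.
Qed.

(** * Degree of the numerator and its divisibility by x^2 (1+x)^2 *)

Lemma coef_eulerian_big t k : (t < k)%N -> (eulerian_poly t)`_k = 0.
Proof.
move=> tk; rewrite coef_sum big_nat big1 // => j jt.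
by rewrite coefZ coefXn (_ : (k == j) = false) ?mulr0 //; lia.
Qed.

Lemma coef_eulerian_top t : (eulerian_poly t.+1)`_t.+1 = 1.
Proof.
elim: t => [|t IHt]; first by rewrite eulerian_poly1 coefX.
rewrite eulerian_poly_rec -mulrA coefD coefXM /= mulrBl mul1r coefB coefXM /=.
rewrite coefZ coefXM /= !coef_deriv (coef_eulerian_big (ltnSn _)) IHt.
by rewrite mul0rn sub0r mulr1 -(natr1 t.+1) addKr.
Qed.

Lemma size_eulerian t : size (eulerian_poly t.+1) = t.+2.
Proof.
apply/eqP; rewrite eqn_leq; apply/andP; split.
  by apply/leq_sizeP => k; apply: coef_eulerian_big.
rewrite ltnNge; apply/negP => /leq_sizeP/(_ t.+1 (leqnn _)).
by rewrite coef_eulerian_top => /eqP; rewrite oner_eq0.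
Qed.

Lemma eulerian_horner1_rec t :
  (eulerian_poly t.+2).[1] = t.+2%:R * (eulerian_poly t.+1).[1].
Proof. by rewrite eulerian_poly_rec !hornerE /= mulr1. Qed.

(* The mean number of descents of a permutation of t.+1 is t / 2. *)
Lemma eulerian_deriv_horner1 t :
  2 * (eulerian_poly t.+1)^`().[1] = t.+2%:R * (eulerian_poly t.+1).[1].
Proof.
elim: t => [|t IHt].
  by rewrite eulerian_poly1 derivX !hornerE.
rewrite eulerian_horner1_rec eulerian_poly_rec !derivE !hornerE /=.
rewrite [X in X = _](_ : _ = t.+1%:R * (2 * (eulerian_poly t.+1)^`().[1]) +
   2 * t.+2%:R * (eulerian_poly t.+1).[1]); last by ring.
by rewrite IHt; ring.
Qed.

Lemma double_root_dvdp (p : {poly rat}) a :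
  root p a -> root p^`() a -> ('X - a%:P) ^+ 2 %| p.
Proof.
move=> /factor_theorem[q ->]; rewrite derivM derivXsubC mulr1 /root !hornerE.
rewrite subrr mulr0 add0r => /factor_theorem[r ->].
by rewrite -mulrA -expr2 dvdp_mull.
Qed.

(** The two factors are coprime. Each A_k with k >= 1 is divisible by x, which gives x^2. At -1 the
    numerator and its derivative reduce to values of A and A' at 1, and these cancel by the two
    recurrences at 1. *)
Lemma numer_dvd t : 'X^2 * (1 + 'X) ^+ 2 %| numer t.+2.
Proof.
have dvdX k : 'X^2 %| eulerian_poly k.+1 \Po 'X^2.
  rewrite eulerian_polyE; under eq_bigr do rewrite exprS.
  by rewrite -mulr_sumr comp_polyM comp_polyX dvdp_mulr.
have -> : 1 + 'X = 'X - (-1)%:P :> {poly rat} by rewrite polyCN opprK addrC.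
rewrite Gauss_dvdp; last first.
  rewrite coprimep_expl // coprimep_expr //.
  by rewrite coprimep_sym coprimepX rootE !hornerE.
apply/andP; split.
  by rewrite /numer subn1 dvdp_add ?dvdX ?dvdp_mull ?dvdX.
have h1 := eulerian_deriv_horner1 t; have h2 := eulerian_horner1_rec t.
have h3 := eulerian_deriv_horner1 t.+1.
apply: double_root_dvdp; rewrite /root /numer subn1 /=; apply/eqP.
  rewrite !hornerE !horner_comp !hornerE.
  by rewrite sqrrN expr1n h2; ring.
rewrite !derivE !deriv_comp !derivE !hornerE !horner_comp !hornerE /=.
rewrite sqrrN expr1n.
transitivity (- (2 * (eulerian_poly t.+2)^`().[1])
    + t.+2%:R * (eulerian_poly t.+1).[1]
    + t.+2%:R * (2 * (eulerian_poly t.+1)^`().[1])); first by ring.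
by rewrite h3 h2 h1; ring.
Qed.

(** The second summand has degree one less than the first, so the leading term survives. *)
Lemma size_numer t : size (numer t.+2) = (2 * t.+2).+1%N.
Proof.
have size_comp k : size (eulerian_poly k.+1 \Po 'X^2) = (2 * k.+1).+1%N.
  have := size_comp_poly (eulerian_poly k.+1) 'X^2.
  rewrite size_eulerian size_polyXn /= mulnC.
  by case: size => [|m] /=; lia.
rewrite /numer subn1 /= size_polyDl size_comp // -scalerAl size_scale;
  last first.
  by rewrite Num.Theory.pnatr_eq0.
rewrite mulrC size_mulX ?size_comp; first by lia.
by rewrite -size_poly_gt0 size_comp.
Qed.

(* The paper's p_(2t-4). *)
Definition quot t : {poly rat} := numer t %/ ('X^2 * (1 + 'X) ^+ 2).

Lemma quotK t : quot t.+2 * ('X^2 * (1 + 'X) ^+ 2) = numer t.+2.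
Proof. by rewrite divpK ?numer_dvd. Qed.

Lemma size_denom : size ('X^2 * (1 + 'X) ^+ 2 : {poly rat}) = 5%N.
Proof.
have -> : 1 + 'X = 'X - (-1)%:P :> {poly rat} by rewrite polyCN opprK addrC.
rewrite size_monicM ?monicXn ?monic_neq0 ?monic_exp ?monicXsubC //.
by rewrite size_polyXn size_exp_XsubC.
Qed.

Lemma mul1B_U0 : (1 - x) * U 0 = 1.
Proof.
apply/fpsP => n; rewrite mulrBl mul1r fcoefD fcoefN fcoefXM.
by case: n => [|n] /=; rewrite !WK_eq /= ?expn0 ?mul0n ?subr0 ?subrr.
Qed.

Lemma mul1B_U1 : (1 - x) * U 1 = U 0.
Proof.
have WK1 n : WK 1 n = n.+1.
  rewrite WK_eq expn1 mul1n.
  under eq_bigr do rewrite expn0.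
  rewrite sum_nat_const_nat muln1 subn1 /= addSn uphalf_half addnCA addnn.
  by rewrite odd_double_half.
apply/fpsP => n; rewrite mulrBl mul1r fcoefD fcoefN fcoefXM.
case: n => [|n] /=; rewrite !WK1 !WK_eq expn0 mul0n addn0 ?subr0 //.
by rewrite -[n.+2%:R]natr1 addrC addKr.
Qed.

End GeneratingFunctions.

Theorem theorem2p7 :
  let x : {fps rat} := fpsX in
  let y : {fps {fps rat}} := fpsX in
  exists p : nat -> {poly rat},
    (forall t : nat, (2 <= t)%N ->
       tofrac (p t) =
         tofrac ((eulerian_poly t \Po 'X^2)
                 + t%:R *: 'X * (eulerian_poly (t - 1)%N \Po 'X^2))
         / tofrac ('X^2 * (1 + 'X) ^+ 2)
       /\ size (p t) = (2 * t - 4).+1%N)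
    /\
    Fps (fun t : nat => U t / (t`!)%:R) =
      fpsC (1 - x)^-1
      + fpsC ((1 - x) ^+ 2)^-1 * y
      + Fps (fun t : nat =>
          if (2 <= t)%N then
            fps_of_poly (p t)
            / ((1 - x) ^+ 3 * (1 - x ^+ 2) ^+ (t - 2)%N) / (t`!)%:R
          else 0).
Proof.
move=> x y.
have denom_neq0 : ('X^2 * (1 + 'X) ^+ 2 : {poly rat}) != 0.
  by rewrite -size_poly_gt0 size_denom.
have unitX k : (1 - x ^+ k.+1) \is a GRing.unit := fps_unit1B _ k.
have unit1 : (1 - x) \is a GRing.unit := unitX 0%N.
exists quot; split=> [[|[|t]] // _|].
  rewrite -/(numer _) -quotK tofracM mulfK ?tofrac_eq0 //; split=> //.
  have := congr1 (fun p : {poly rat} => size p) (quotK t).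
  have quot_neq0 : quot t.+2 != 0.
    apply/eqP => q0; have := size_numer t.
    by rewrite -quotK q0 mul0r size_poly0.
  by rewrite size_mul // size_denom size_numer; move: (size _) => m; lia.
apply/(proj1 (fpsP _ _)) => t; rewrite !fcoefD fcoefCM.
case: t => [|[|t]].
- rewrite [fcoef _ _ in LHS]/= divr1 /= mulr0 !addr0.
  by apply: (mulrI unit1); rewrite mulrV // mul1B_U0.
- rewrite [fcoef _ _ in LHS]/= divr1 /= mulr1 add0r addr0.
  have unit2 : (1 - x) ^+ 2 \is a GRing.unit by rewrite unitrX.
  apply: (mulrI unit2).
  by rewrite mulrV // expr2 -mulrA mul1B_U1 mul1B_U0.
rewrite [fcoef _ _ in LHS]/= [X in _ = _ + X]/= [fcoef _ _]/= mulr0 !add0r.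
rewrite subSS subn1 /=; congr (_ / _).
have u1V : (1 - x) ^+ 3 * (1 - x ^+ 2) ^+ t \is a GRing.unit.
  by rewrite unitrM !unitrX.
apply: (mulIr u1V); rewrite divrK //.
have U_E : x ^+ 2 * U t.+2 * (1 - x ^+ 2) ^+ t.+3 =
    (1 + x) * (fps_of_poly (quot t.+2) * (x ^+ 2 * (1 + x) ^+ 2)).
  rewrite U_numer -quotK 2!fps_of_polyM; do 3![congr (_ * _)].
    by rewrite rmorphXn /= fps_of_polyX.
  by rewrite rmorphXn rmorphD /= fps_of_poly1 fps_of_polyX.
have u1D : (1 + x) ^+ 3 \is a GRing.unit.
  have : (1 - x) * (1 + x) \is a GRing.unit.
    by rewrite (_ : _ * _ = 1 - x ^+ 2) ?unitX //; ring.
  by rewrite unitrM => /andP[_ /unitrX].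
(* Multiplying by x^2 (1+x)^3 completes (1-x)^3 (1-x^2)^t to (1-x^2)^(t+3), the power in [U_E]. *)
apply: (@fpsX_lreg rat); apply: (@fpsX_lreg rat); apply: (mulIr u1D).
rewrite -/x.
transitivity ((1 + x) * (fps_of_poly (quot t.+2) * (x ^+ 2 * (1 + x) ^+ 2)));
  last by ring.
by rewrite -U_E !exprS; ring.
Qed.
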